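(* Let $M$ and $M'$ be smooth (abstract) CR-manifolds with $\dim M=\dim M'$. Suppose that there exist a number $r$ and a smooth map $\Phi\colon G^r(M,M')\to J^{r+1}(M,M')$ such that every smooth CR-diffeomorphism $f$ between open pieces of $M$ and $M'$ satisfies $j_x^{r+1}f\equiv\Phi(x,j_x^rf)$ for all $x$ in the domain of definition of $f$. Then (smooth) CR-diffeomorphisms between connected open pieces of $M$ and $M'$ are uniquely determined by their $r$-jets at any point, i.e. if $f,g\colon U\subset M\to M'$ are CR-diffeomorphisms (onto open pieces of $M'$), $U$ is connected, $p\in U$ and $j_p^rf=j_p^rg$, then $f\equiv g$.
   Context: ''Smooth'' means $\mathcal C^\infty$. An (abstract) CR-manifold of CR-dimension $n$ and CR-codimension $d$ is a smooth real $(2n+d)$-dimensional manifold $M$ together with a subbundle $T^cM\subset TM$ of rank $2n$ and a bundle automorphism $J\colon T^cM\to T^cM$ with $J^2=-\mathrm{id}$ such that the commutator of any two $(0,1)$ vector fields (sections of the bundle of vectors $X+iJX$, $X\in T^cM$) is again a $(0,1)$ vector field. A map $f\colon M\to M'$ is CR if $df(T^cM)\subset T^cM'$ and $df\circ J=J'\circ df$ on $T^cM$; a CR-diffeomorphism is a diffeomorphism $f$ such that $f$ and $f^{-1}$ are CR. An open piece is an open subset. $J^k(M,M')$ is the bundle of all $k$-jets of smooth maps between open pieces of $M$ and $M'$; $j_x^kf$ is the $k$-jet of $f$ at $x$, and $(x,j_x^kf)$ denotes the corresponding element of $J^k(M,M')$. If $\dim M=\dim M'$, $G^k(M,M')\subset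 J^k(M,M')$ is the open subset of all jets of (locally) invertible maps. *)

(* Defs.v *)
From mathcomp Require Import all_boot all_order all_algebra.
From mathcomp Require Import all_classical all_reals all_analysis.

Set Implicit Arguments.
Unset Strict Implicit.
Unset Printing Implicit Defensive.

Import Order.TTheory GRing.Theory Num.Theory.
Import numFieldNormedType.Exports.

Local Open Scope classical_set_scope.
Local Open Scope ring_scope.

Section EuclideanSmoothness.
Context {R : realType} {m m' : nat}.
Implicit Types (V : set 'rV[R]_m) (h : 'rV[R]_m -> 'rV[R]_m').

(* For s = [:: i_1; ...; i_k], the iterated partial derivative
   d_{i_1} (... (d_{i_k} h)). *)
Definition partial (s : seq 'I_m) h : 'rV[R]_m -> 'rV[R]_m' :=
  foldr (fun i g u => 'D_(delta_mx 0 i) g u) h s.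

(* h is C^oo on V; only used for open V. *)
Definition csmooth V h : Prop :=
  forall (s : seq 'I_m) u, V u ->
    {for u, continuous (partial s h)} /\
    forall i : 'I_m, derivable (partial s h) u (delta_mx 0 i).

End EuclideanSmoothness.

(* A chart [coord] on [dom], together with a total extension [param] of its
   inverse. *)
Record chart (R : realType) (m : nat) (T : Type) := Chart {
  dom : set T;
  coord : T -> 'rV[R]_m;
  param : 'rV[R]_m -> T }.

Definition cod (R : realType) (m : nat) (T : Type) (a : chart R m T) :
  set 'rV[R]_m := coord a @` dom a.

(* The atlas is not required to be maximal. *)
Record smooth_manifold (R : realType) (m : nat) := SmoothManifold {
  carrier :> topologicalType;
  atlas : set (chart R m carrier);
  manifold_hausdorff : hausdorff_space carrier;
  manifold_second_countable : @second_countable carrier;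
  atlas_cover : forall x : carrier, exists2 a, atlas a & dom a x;
  chart_dom_open : forall a, atlas a -> open (dom a);
  chart_cod_open : forall a, atlas a -> open (cod a);
  chart_coordK : forall a, atlas a ->
    forall x, dom a x -> param a (coord a x) = x;
  chart_coord_continuous : forall a, atlas a ->
    forall x, dom a x -> {for x, continuous (coord a)};
  chart_param_continuous : forall a, atlas a ->
    forall u, cod a u -> {for u, continuous (param a)};
  atlas_compatible : forall a b, atlas a -> atlas b ->
    csmooth (coord a @` (dom a `&` dom b)) (coord b \o param a) }.

(* A map from an open piece U of M to M' is represented by a total function
   M -> M', whose values outside of U are irrelevant. *)
Section SmoothMaps.
Context {R : realType} {m m' : nat}.
Variables (M : smooth_manifold R m) (M' : smooth_manifold R m').
Implicit Types (U : set M) (f g : M -> M') (x : M) (k : nat).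

Definition local_expr (a : chart R m M) (b : chart R m' M') f :
  'rV[R]_m -> 'rV[R]_m' := coord b \o f \o param a.

Definition smooth_on U f : Prop :=
  (forall x, U x -> {for x, continuous f}) /\
  forall a b, atlas a -> atlas b ->
    csmooth (coord a @` (dom a `&` U `&` f @^-1` dom b)) (local_expr a b f).

Definition smooth_near x f : Prop :=
  exists U, [/\ open U, U x & smooth_on U f].

Definition same_jet k x f g : Prop :=
  f x = g x /\
  forall a b, atlas a -> atlas b -> dom a x -> dom b (f x) ->
    forall s : seq 'I_m, (size s <= k)%N ->
      partial s (local_expr a b f) (coord a x) =
      partial s (local_expr a b g) (coord a x).

(* The k-jet of f at x, as the set of all maps that are smooth near x and
   agree with f to order k at x. *)
Definition jet k x f : set (M -> M') :=
  [set g | smooth_near x g /\ same_jet k x f g].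

(* The bundle of k-jets, as a set of pairs (x, j). *)
Definition jet_bundle k : set (M * set (M -> M')) :=
  [set z | exists x f, smooth_near x f /\ z = (x, jet k x f)].

(* The multi-indices of order at most k, a multi-index being written as a
   nondecreasing sequence i_1 <= ... <= i_j with j <= k. *)
Definition multi_index k : finType :=
  {s : k.-bseq 'I_m | sorted (fun i j : 'I_m => (i <= j)%N) s}.

(* Coordinates of (x, jet k x f) in the chart of the jet bundle induced by
   the charts a and b: the coordinates of x, followed by all the partial
   derivatives of order at most k of the local expression of f. *)
Definition jet_coord (a : chart R m M) (b : chart R m' M') k x f :
    'rV[R]_(m + #|multi_index k| * m') :=
  row_mx (coord a x)
    (mxvec (\matrix_(i < #|multi_index k|)
       partial (val (enum_val i)) (local_expr a b f) (coord a x))).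

(* The graph of the chart of the k-jet bundle induced by a and b. *)
Definition jet_chart (a : chart R m M) (b : chart R m' M') k
    (z : M * set (M -> M')) (w : 'rV[R]_(m + #|multi_index k| * m')) : Prop :=
  exists x f, [/\ smooth_near x f, z = (x, jet k x f),
                  dom a x, dom b (f x) & w = jet_coord a b k x f].

End SmoothMaps.

Arguments jet_bundle {R m m'} M M' k.
Arguments jet_chart {R m m' M M'} a b k z w.

Section Diffeomorphisms.
Context {R : realType} {m m' : nat}.
Variables (M : smooth_manifold R m) (M' : smooth_manifold R m').

(* f restricts to a diffeomorphism from the open piece U onto an open piece
   of M', and g extends the inverse. *)
Definition diffeo_with_inverse (U : set M) (f : M -> M') (g : M' -> M) :
    Prop :=
  [/\ open U, open (f @` U), forall x, U x -> g (f x) = x,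
      smooth_on U f & smooth_on (f @` U) g].

Definition locally_invertible (x : M) (f : M -> M') : Prop :=
  exists U g, U x /\ diffeo_with_inverse U f g.

(* G^k(M, M'). *)
Definition invertible_jets k : set (M * set (M -> M')) :=
  [set z | exists x f, locally_invertible x f /\ z = (x, jet k x f)].

(* Smoothness of a map from G^k(M, M') to the l-jet bundle: in the charts of
   the jet bundles, Phi has a C^oo local expression h near every point.  Only
   the values of h at coordinates of elements of G^k are constrained; as G^k
   is open, these contain a neighbourhood of w. *)
Definition smooth_jet_map k l
    (Phi : M * set (M -> M') -> M * set (M -> M')) : Prop :=
  forall z, invertible_jets k z ->
  forall a b a' b', atlas a -> atlas b -> atlas a' -> atlas b' ->
  forall w w', jet_chart a b k z w -> jet_chart a' b' l (Phi z) w' ->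
  exists W h,
    [/\ open W, W w, csmooth W h
      & forall z1 w1, invertible_jets k z1 -> jet_chart a b k z1 w1 -> W w1 ->
          jet_chart a' b' l (Phi z1) (h w1)].

End Diffeomorphisms.

Arguments invertible_jets {R m m'} M M' k.
Arguments smooth_jet_map {R m m'} M M' k l Phi.

(* A tangent vector at x is represented by its components v in a chart a
   around x; its components in another chart b around x are
   'D_v (coord b \o param a) (coord a x).  Correspondingly, a local vector
   field in a chart is a map 'rV_m -> 'rV_m on an open subset of cod a.  A
   local complex vector field X + i Y is the pair (X, Y). *)
Section VectorFields.
Context {R : realType} {m : nat}.
Local Notation field := ('rV[R]_m -> 'rV[R]_m).

Definition bracket (X Y : field) : field :=
  fun u => 'D_(X u) Y u - 'D_(Y u) X u.

Definition cbracket (Z W : field * field) : field * field :=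
  (bracket Z.1 W.1 \- bracket Z.2 W.2, bracket Z.1 W.2 \+ bracket Z.2 W.1).

Definition section_on (V : set 'rV[R]_m) (H : 'rV[R]_m -> {vspace 'rV[R]_m})
    (X : field) : Prop :=
  csmooth V X /\ forall u, V u -> X u \in H u.

Definition field01_on (V : set 'rV[R]_m) (H : 'rV[R]_m -> {vspace 'rV[R]_m})
    (J : 'rV[R]_m -> 'End('rV[R]_m)) (Z : field * field) : Prop :=
  section_on V H Z.1 /\ forall u, V u -> Z.2 u = J u (Z.1 u).

End VectorFields.

(* CR-manifolds of CR-dimension n and CR-codimension d.  For u in cod a,
   Tc a u is the fibre of T^cM at the point with coordinates u, expressed in
   the chart a, and J a u is an endomorphism of the whole of 'rV of which only
   the restriction to Tc a u is relevant. *)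
Record cr_manifold (R : realType) (n d : nat) := CRManifold {
  cr_base :> smooth_manifold R (n.*2 + d);
  Tc : chart R (n.*2 + d) cr_base ->
       'rV[R]_(n.*2 + d) -> {vspace 'rV[R]_(n.*2 + d)};
  J : chart R (n.*2 + d) cr_base ->
      'rV[R]_(n.*2 + d) -> 'End('rV[R]_(n.*2 + d));
  Tc_dim : forall a, atlas a -> forall u, cod a u -> \dim (Tc a u) = n.*2;
  Tc_smooth : forall a, atlas a -> forall u, cod a u ->
    exists V (X : 'I_n.*2 -> 'rV[R]_(n.*2 + d) -> 'rV[R]_(n.*2 + d)),
      [/\ open V, V u, V `<=` cod a, forall i, csmooth V (X i)
        & forall w, V w -> Tc a w = <<codom (fun i => X i w)>>%VS];
  J_stable : forall a, atlas a -> forall u, cod a u ->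
    forall v, v \in Tc a u -> J a u v \in Tc a u;
  J_square : forall a, atlas a -> forall u, cod a u ->
    forall v, v \in Tc a u -> J a u (J a u v) = - v;
  J_smooth : forall a, atlas a -> forall V, open V -> V `<=` cod a ->
    forall X, section_on V (Tc a) X -> csmooth V (fun u => J a u (X u));
  Tc_transition : forall a b, atlas a -> atlas b ->
    forall x, dom a x -> dom b x -> forall v, v \in Tc a (coord a x) ->
    'D_v (coord b \o param a) (coord a x) \in Tc b (coord b x);
  J_transition : forall a b, atlas a -> atlas b ->
    forall x, dom a x -> dom b x -> forall v, v \in Tc a (coord a x) ->
    'D_(J a (coord a x) v) (coord b \o param a) (coord a x) =
    J b (coord b x) ('D_v (coord b \o param a) (coord a x));
  cr_integrable : forall a, atlas a -> forall V, open V -> V `<=` cod a ->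
    forall Z W, field01_on V (Tc a) (J a) Z -> field01_on V (Tc a) (J a) W ->
    field01_on V (Tc a) (J a) (cbracket Z W) }.

Definition cr_on (R : realType) (n d n' d' : nat)
    (M : cr_manifold R n d) (M' : cr_manifold R n' d')
    (U : set M) (f : M -> M') : Prop :=
  forall a b, atlas a -> atlas b ->
  forall x, U x -> dom a x -> dom b (f x) ->
  forall v, v \in Tc a (coord a x) ->
    'D_v (local_expr a b f) (coord a x) \in Tc b (coord b (f x)) /\
    'D_(J a (coord a x) v) (local_expr a b f) (coord a x) =
    J b (coord b (f x)) ('D_v (local_expr a b f) (coord a x)).

(* f restricts to a CR-diffeomorphism from the open piece U of M onto the open
   piece f @` U of M'. *)
Definition cr_diffeo (R : realType) (n d n' d' : nat)
    (M : cr_manifold R n d) (M' : cr_manifold R n' d')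
    (U : set M) (f : M -> M') : Prop :=
  exists g : M' -> M,
    [/\ diffeo_with_inverse U f g, cr_on U f & cr_on (f @` U) g].

(* Main.v *)
Require Import Defs.
From mathcomp Require Import all_boot all_order all_algebra.
From mathcomp Require Import all_classical all_reals all_analysis.
From mathcomp Require Import ring lra.

Set Implicit Arguments.
Unset Strict Implicit.
Unset Printing Implicit Defensive.

Import Order.TTheory GRing.Theory Num.Theory.
Import numFieldNormedType.Exports.

Local Open Scope classical_set_scope.

(** Let [S] be the set of points of [U] where [f] and [g] have the same [r]-jet.
    It contains [p], and it is enough to show that it is closed and open in the
    connected set [U].

    It is closed because, in charts, the coordinates of the jets of [f] and [g]
    are continuous functions of the point ([same_jet_closed]).

    It is open because [f] and [g] agree near every point of [S]
    ([jet_relation_near_eq]). Both maps satisfy the relation given by [Phi],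
    which in charts expresses the partial derivatives of order [r.+1] as smooth
    functions of the point and of the derivatives of order at most [r]. Such a
    complete system determines its solutions by their [r]-jets at one point
    ([jet_system_unique]): the vector of all derivatives of order at most [r]
    has first derivatives that are Lipschitz functions of this vector, so the
    difference [Q] of the two vectors satisfies [`|dQ| <= L * `|Q|] and vanishes
    near any of its zeros ([derive_le_self_eq0]).

    Coordinates on the jet bundles contain each mixed partial derivative only
    once, with its indices sorted. Differentiating such a coordinate breaks the
    order, hence the need for the symmetry of second derivatives
    ([mixed_derivative], [partial_perm]). *)

(** * Mean value inequalities and second derivatives *)

Section MeanValue.
Local Open Scope ring_scope.
Context {R : realType}.

Lemma mx_norm_le m n (A : 'M[R]_(m, n)) (e : R) : 0 <= e ->
  (`|A| <= e) <-> (forall i j, `|A i j| <= e).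
Proof.
move=> e0; rewrite [`|A|]/Num.Def.normr /= mx_normrE; split=> [Ae i j|Ae].
  by apply: le_trans Ae; exact: (le_bigmax _ (fun ij => `|A ij.1 ij.2|) (i, j)).
by apply: bigmax_le => // -[i j] _; exact: Ae.
Qed.

Lemma coord_le_mx_norm m n (A : 'M[R]_(m, n)) i j : `|A i j| <= `|A|.
Proof. by have /(mx_norm_le A) : 0 <= `|A| by []; case=> + _; exact. Qed.

(** The increment [t] may be negative: this is what makes the later walks along
    coordinate axes insensitive to the sign of each step. *)
Lemma mean_value_real (g : R -> R) (t : R) :
  (forall s, 0 <= s <= 1 -> derivable g (s * t) 1) ->
  exists s, 0 <= s <= 1 /\ g t - g 0 = t * 'D_1 g (s * t).
Proof.
move=> dg.
have [->|t0] := eqVneq t 0.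
  by exists 0; rewrite subrr mul0r lexx ler01.
have dgI s : 0 <= s / t <= 1 -> derivable g s 1.
  by move=> /dg; rewrite divfK.
have mid s : 0 <= s / t <= 1 -> exists s', 0 <= s' <= 1 /\ s = s' * t.
  by move=> ?; exists (s / t); rewrite divfK.
have main a b : a <= b -> (forall s, s \in `[a, b] -> 0 <= s / t <= 1) ->
    exists s, 0 <= s <= 1 /\ g b - g a = (b - a) * 'D_1 g (s * t).
  move=> ab abI.
  have [||s sab gE] := MVT_segment (df := 'D_1 g) ab (f := g).
  - by move=> s sab; apply/derivableP/dgI/abI/subset_itv_oo_cc.
  - by apply: derivable_within_continuous => s sab; exact/dgI/abI.
  - have [s' [s'01 E]] := mid _ (abI _ sab).
    by exists s'; rewrite -E mulrC.
case: (ltgtP t 0) t0 => // t0 _.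
- have [||s [s01 E]] := main t 0; first exact: ltW.
    move=> s; rewrite in_itv/= => /andP[ts s0].
    by rewrite ler_ndivrMr// ler_ndivlMr// mul0r mul1r s0 ts.
  exists s; split=> //; rewrite -opprB E; ring.
- have [||s [s01 E]] := main 0 t; first exact: ltW.
    move=> s; rewrite in_itv/= => /andP[ts s0].
    by rewrite ler_pdivrMr// ler_pdivlMr// mul0r mul1r s0 ts.
  by exists s; split=> //; rewrite E subr0.
Qed.

Lemma is_derive_line m (q : 'rV[R]_m -> R) (u v : 'rV[R]_m) (t : R) :
  derivable q (u + t *: v) v ->
  is_derive t 1 (fun s => q (u + s *: v)) ('D_v q (u + t *: v)).
Proof.
move=> dq.
have E : (fun h => h^-1 *: (q (u + (h *: 1 + t) *: v) - q (u + t *: v))) =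
         (fun h => h^-1 *: (q (h *: v + (u + t *: v)) - q (u + t *: v))).
  apply/funext => h; congr (_ *: (q _ - _)).
  by rewrite [h *: 1]mulr1 scalerDl addrCA.
by split; rewrite /derivable /derive /= E.
Qed.

Lemma mean_value_line m (q : 'rV[R]_m -> R) (u v : 'rV[R]_m) (t : R) :
  (forall s, 0 <= s <= 1 -> derivable q (u + (s * t) *: v) v) ->
  exists s, 0 <= s <= 1 /\
    q (u + t *: v) - q u = t * 'D_v q (u + (s * t) *: v).
Proof.
move=> dq; have [|s [s01 E]] := @mean_value_real (fun s => q (u + s *: v)) t.
  by move=> s /dq/is_derive_line [].
exists s; split=> //; move: E; rewrite scale0r addr0 => ->; congr (_ * _).
by have /dq/is_derive_line[] := s01.
Qed.

(** Walk from [u] to [w] changing one coordinate at a time.  The norm is the sup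
    norm, so the ball is a cube and contains every corner and every segment of
    the walk; each of the [m] steps costs at most [C * `|w - u|].  Only partial
    derivatives occur, which is what [csmooth] provides. *)
Lemma mean_value_cube m (q : 'rV[R]_m -> R) (c : 'rV[R]_m) (e C : R) :
  (forall y, `|y - c| <= e -> forall i : 'I_m,
     derivable q y (delta_mx 0 i) /\ `|'D_(delta_mx 0 i) q y| <= C) ->
  forall u w, `|u - c| <= e -> `|w - c| <= e ->
    `|q w - q u| <= m%:R * (C * `|w - u|).
Proof.
move=> dq u w ue we.
have e0 : 0 <= e by exact: le_trans ue.
have /(mx_norm_le _ e0) ue' := ue; have /(mx_norm_le _ e0) we' := we.
(* T he corner reached after [k] steps: coordinates below [k] are those of [w].
   *)
pose mix k : 'rV[R]_m := \row_j (if (j < k)%N then w 0 j else u 0 j).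
have mix0 : mix 0%N = u by apply/rowP => j; rewrite mxE ltn0.
have mixm : mix m = w by apply/rowP => j; rewrite mxE ltn_ord.
suff H k : (k <= m)%N -> `|q (mix k) - q u| <= k%:R * (C * `|w - u|).
  by rewrite -{1}mixm; exact: H.
elim: k => [_|k IH km]; first by rewrite mix0 subrr normr0 mul0r.
pose i := Ordinal km.
have mixS : mix k.+1 = mix k + (w 0 i - u 0 i) *: delta_mx 0 i.
  apply/rowP => j; rewrite !mxE ltnS leq_eqVlt eqxx/=.
  have [->|] := eqVneq j i; first by rewrite /= eqxx ltnn mulr1 addrC subrK.
  by rewrite -val_eqE /= => /negPf ->; rewrite mulr0 addr0.
have mixe s : 0 <= s <= 1 ->
    `|mix k + (s * (w 0 i - u 0 i)) *: delta_mx 0 i - c| <= e.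
  move=> /andP[s0 s1]; apply/mx_norm_le => // o j; rewrite (ord1 o) !mxE eqxx/=.
  have := ue' 0 j; have := we' 0 j; rewrite !mxE !ler_norml.
  move=> /andP[w1 w2] /andP[u1 u2].
  have [ji|ji] := eqVneq j i; last by rewrite mulr0 addr0; case: ifP; lra.
  rewrite {}ji /= ltnn mulr1 in w1 w2 u1 u2 *.
  have s1' : 0 <= 1 - s by rewrite subr_ge0.
  have := mulr_ge0 s0 (_ : 0 <= e - (w 0 i - c 0 i)).
  have := mulr_ge0 s0 (_ : 0 <= (w 0 i - c 0 i) + e).
  have := mulr_ge0 s1' (_ : 0 <= e - (u 0 i - c 0 i)).
  have := mulr_ge0 s1' (_ : 0 <= (u 0 i - c 0 i) + e).
  by do 4![move=> /(_ ltac:(lra)) ?]; apply/andP; split; lra.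
have [|s [s01 E]] := mean_value_line (t := w 0 i - u 0 i) (q := q)
  (u := mix k) (v := delta_mx 0 i).
  by move=> s /mixe/dq /(_ i)[].
have [_ Dq] := dq _ (mixe s s01) i.
have wui : `|w 0 i - u 0 i| <= `|w - u|.
  by have := coord_le_mx_norm (w - u) 0 i; rewrite !mxE.
have C0 : 0 <= C by exact: le_trans Dq.
have -> : q (mix k.+1) - q u = (q (mix k) - q u) +
    (w 0 i - u 0 i) * 'D_(delta_mx 0 i) q
      (mix k + (s * (w 0 i - u 0 i)) *: delta_mx 0 i).
  by rewrite mixS -E; ring.
rewrite -[k.+1%:R]natr1 [leRHS]mulrDl mul1r.
rewrite (le_trans (ler_normD _ _))// lerD//; first exact: IH (ltnW km).
by rewrite normrM mulrC ler_pM.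
Qed.

End MeanValue.

Section MixedPartials.
Local Open Scope ring_scope.
Context {R : realType} {m : nat}.

(** Two applications of the mean value theorem: first along [v] to the
    difference in the direction [w], then along [w] to the derivative along [v].
    The left side is symmetric in [v] and [w]. *)
Lemma second_difference (q : 'rV[R]_m -> R) (u v w : 'rV[R]_m) (e : R) :
  0 < e ->
  (forall a b, 0 <= a <= e -> 0 <= b <= e ->
     derivable q (u + a *: v + b *: w) v /\
     derivable ('D_v q) (u + a *: v + b *: w) w) ->
  exists a b, [/\ 0 <= a <= e, 0 <= b <= e &
    q (u + e *: v + e *: w) - q (u + e *: v) - (q (u + e *: w) - q u) =
    e * (e * 'D_w ('D_v q) (u + a *: v + b *: w))].
Proof.
move=> e0 dq.
have e01 s : 0 <= s <= 1 -> 0 <= s * e <= e.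
  by move=> /andP[s0 s1]; have e0W := ltW e0; rewrite mulr_ge0//= ler_piMl.
have e00 : 0 <= (0 : R) <= e by rewrite lexx ltW.
have ee : 0 <= e <= e by rewrite lexx ltW.
pose g (x : 'rV[R]_m) := q (x + e *: w) - q x.
have dshift a : 0 <= a <= e ->
    is_derive (u + a *: v) v (fun x => q (x + e *: w))
      ('D_v q (u + a *: v + e *: w)).
  move=> ae; have [dqe _] := dq a e ae ee.
  have E : (fun h => h^-1 *: (q (h *: v + (u + a *: v) + e *: w) -
                              q (u + a *: v + e *: w))) =
           (fun h => h^-1 *: (q (h *: v + (u + a *: v + e *: w)) -
                              q (u + a *: v + e *: w))).
    by apply/funext => h; rewrite [in RHS]addrA.
  by split; rewrite /derivable /derive /= E.
have dq0 a : 0 <= a <= e -> derivable q (u + a *: v) v.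
  by move=> ae; have [] := dq a 0 ae e00; rewrite scale0r addr0.
have dg a : 0 <= a <= e -> is_derive (u + a *: v) v g
    ('D_v q (u + a *: v + e *: w) - 'D_v q (u + a *: v)).
  by move=> ae; apply: is_deriveB; [exact: dshift|exact/derivableP/dq0].
have [|s [s01 E1]] := mean_value_line (t := e) (q := g) (u := u) (v := v).
  by move=> s /e01/dg [].
have [|t [t01 E2]] := mean_value_line (t := e) (q := 'D_v q)
    (u := u + (s * e) *: v) (v := w).
  by move=> t /e01 te; have [] := dq (s * e) (t * e) (e01 _ s01) te.
exists (s * e), (t * e); split; rewrite ?e01//.
have [_ Dg] := dg _ (e01 _ s01).
by move: E1; rewrite Dg E2 /g.
Qed.

Lemma ler_dist_half (x y z e : R) :
  `|x - y| < e / 2 -> `|z - y| < e / 2 -> `|x - z| <= e.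
Proof. by rewrite !ltr_norml ler_norml; lra. Qed.

(** Symmetry of second derivatives. Dividing the second difference by its
    squared step shows that each mixed derivative takes, at some point close to
    [u], the same value as the other one at another such point; continuity at
    [u] then leaves no room for a difference. *)
Lemma mixed_derivative (q : 'rV[R]_m -> R) (u v w : 'rV[R]_m) :
  (\forall y \near u, [/\ derivable q y v, derivable q y w,
     derivable ('D_v q) y w & derivable ('D_w q) y v]) ->
  {for u, continuous ('D_w ('D_v q))} -> {for u, continuous ('D_v ('D_w q))} ->
  'D_w ('D_v q) u = 'D_v ('D_w q) u.
Proof.
move=> dq c1 c2; apply/eqP; rewrite -subr_eq0 -normr_le0.
apply/ler_addgt0Pl => e e0; rewrite addr0.
have e20 : 0 < e / 2 by rewrite divr_gt0.
have : \forall y \near u, [/\ [/\ derivable q y v, derivable q y w,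
    derivable ('D_v q) y w & derivable ('D_w q) y v],
    `|'D_w ('D_v q) u - 'D_w ('D_v q) y| < e / 2 &
    `|'D_v ('D_w q) u - 'D_v ('D_w q) y| < e / 2].
  have n1 : \forall y \near u, `|'D_w ('D_v q) u - 'D_w ('D_v q) y| < e / 2.
    by move/cvgrPdist_lt: c1; apply.
  have n2 : \forall y \near u, `|'D_v ('D_w q) u - 'D_v ('D_w q) y| < e / 2.
    by move/cvgrPdist_lt: c2; apply.
  by apply: filterS3 dq n1 n2 => y; split.
move=> /nbhs_ballP[d /= d0 dP].
pose N := `|v| + `|w| + 1.
have N0 : 0 < N by rewrite ltr_wpDl ?addr_ge0.
(* With steps at most [t], the parallelogram based at [u] stays in the ball. *)
pose t := d / 2 / N.
have t0 : 0 < t by rewrite !divr_gt0.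
have near_u a b : 0 <= a <= t -> 0 <= b <= t -> ball u d (u + a *: v + b *: w).
  move=> /andP[a0 at_] /andP[b0 bt]; rewrite -ball_normE /ball_/=.
  rewrite -addrA opprD addNKr normrN.
  have dE : d = 2 * (t * N) by rewrite divfK ?gt_eqF//; field.
  rewrite (le_lt_trans (ler_normD _ _))// !normrZ !ger0_norm//.
  rewrite {}dE /N; have := normr_ge0 v; have := normr_ge0 w; nra.
have [|a1 [b1 [a1t b1t E1]]] := @second_difference q u v w t t0.
  move=> a b at_ bt; have [[d1 _ d2 _] _ _] := dP _ (near_u a b at_ bt).
  exact: conj d1 d2.
have [|a2 [b2 [a2t b2t E2]]] := @second_difference q u w v t t0.
  move=> a b at_ bt; have [[_ d1 _ d2] _ _] := dP _ (near_u b a bt at_).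
  by rewrite addrAC; exact: conj d1 d2.
have [_ P1 _] := dP _ (near_u a1 b1 a1t b1t).
have [_ _ P2] := dP _ (near_u b2 a2 b2t a2t).
have E : 'D_w ('D_v q) (u + a1 *: v + b1 *: w) =
         'D_v ('D_w q) (u + b2 *: v + a2 *: w).
  apply: (mulfI (lt0r_neq0 t0)); apply: (mulfI (lt0r_neq0 t0)).
  have exchange (x y z x' : R) : x - y - (z - x') = x - z - (y - x') by ring.
  apply: etrans (esym E1) (etrans (exchange _ _ _ _) _).
  apply: etrans (_ : q (u + t *: w + t *: v) - q (u + t *: w) -
    (q (u + t *: v) - q u) = _).
    by congr (q _ - _ - _); exact: addrAC.
  apply: etrans E2 _.
  by congr (_ * (_ * 'D_v ('D_w q) _)); exact: addrAC.
by apply: ler_dist_half P1 _; rewrite E; exact: P2.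
Qed.

End MixedPartials.

(** * Smooth maps between Euclidean spaces *)

Section SmoothCalculus.
Local Open Scope ring_scope.
Context {R : realType}.

Lemma coord_derivable m n p (h : 'rV[R]_m -> 'M[R]_(n, p)) u v i j :
  derivable h u v -> derivable (fun y => h y i j) u v.
Proof. by move/derivable_mxP; exact. Qed.

Lemma coord_derive m n p (h : 'rV[R]_m -> 'M[R]_(n, p)) u v i j :
  derivable h u v -> 'D_v (fun y => h y i j) u = ('D_v h u) i j.
Proof. by move=> dh; rewrite (derive_mx dh) mxE. Qed.

Lemma continuous_coord m n p (h : 'rV[R]_m -> 'M[R]_(n, p)) u i j :
  {for u, continuous h} -> {for u, continuous (fun y => h y i j)}.
Proof.
by move=> ch; exact: (continuous_comp ch (@coord_continuous _ _ _ i j _)).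
Qed.

Lemma near_eq_continuous (T U : topologicalType) (f g : T -> U) x :
  (\near x, f x = g x) -> {for x, continuous f} -> {for x, continuous g}.
Proof.
move=> E cf; rewrite /prop_for /continuous_at -(nbhs_singleton E).
by apply: cvg_trans cf; exact: near_eq_cvg.
Qed.

Lemma partial_swap m m' (V : set 'rV[R]_m) (h : 'rV[R]_m -> 'rV[R]_m')
    (i j : 'I_m) s u : open V -> csmooth V h -> V u ->
  partial [:: i, j & s] h u = partial [:: j, i & s] h u.
Proof.
move=> oV sh Vu /=; set q := partial s h.
have dq y k : V y -> derivable q y (delta_mx 0 k).
  by move=> Vy; have [_] := sh s y Vy; apply.
have dDq y k l : V y -> derivable ('D_(delta_mx 0 k) q) y (delta_mx 0 l).
  by move=> Vy; have [_] := sh (k :: s) y Vy; apply.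
have nV : \forall y \near u, V y by exact: open_nbhs_nbhs.
(* The symmetry lemma is about real functions: pass to the entries of [q]. *)
have DD o l k k' y : V y ->
    derivable ('D_(delta_mx 0 k) (fun z => q z o l)) y (delta_mx 0 k') /\
    'D_(delta_mx 0 k') ('D_(delta_mx 0 k) (fun z => q z o l)) y =
    ('D_(delta_mx 0 k') ('D_(delta_mx 0 k) q) y) o l.
  move=> Vy.
  have E : \near y, ('D_(delta_mx 0 k) q y) o l =
      'D_(delta_mx 0 k) (fun z => q z o l) y.
    near=> z; apply/esym/coord_derive/dq; near: z.
    exact: open_nbhs_nbhs.
  split; first by apply: near_eq_derivable E _; exact/coord_derivable/dDq.
  by rewrite -(near_eq_derive _ E); apply/coord_derive/dDq.
have cont o l k k' : {for u, continuous
    ('D_(delta_mx 0 k') ('D_(delta_mx 0 k) (fun z => q z o l)))}.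
  have [ch _] := sh [:: k', k & s] u Vu.
  apply: near_eq_continuous (continuous_coord (i := o) (j := l) ch).
  by apply: filterS nV => z Vz; apply/esym; exact: (DD o l k k' z Vz).2.
apply/matrixP => o l.
apply: etrans (esym (DD o l j i u Vu).2) _.
apply: etrans (DD o l i j u Vu).2.
apply: mixed_derivative; [|exact: cont|exact: cont].
apply: filterS nV => y Vy.
split; [exact/coord_derivable/dq|exact/coord_derivable/dq|
  exact: (DD _ _ _ _ _ Vy).1|exact: (DD _ _ _ _ _ Vy).1].
Unshelve. all: by end_near. Qed.

(** Jet coordinates record only the partial derivatives along nondecreasing
    sequences of indices; this is what recovers all the others from them. *)
Lemma partial_perm m m' (V : set 'rV[R]_m) (h : 'rV[R]_m -> 'rV[R]_m') s t u :
  open V -> csmooth V h -> perm_eq s t -> V u -> partial s h u = partial t h u.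
Proof.
move=> oV sh.
have cong i s1 s2 : (forall y, V y -> partial s1 h y = partial s2 h y) ->
    forall y, V y -> partial (i :: s1) h y = partial (i :: s2) h y.
  move=> E y Vy; apply: near_eq_derive; near=> z; apply: E; near: z.
  exact: open_nbhs_nbhs.
have move_front i t1 t2 y : V y ->
    partial (i :: t1 ++ t2) h y = partial (t1 ++ i :: t2) h y.
  elim: t1 y => [//|j t1 IH] y Vy.
  by rewrite cat_cons (partial_swap _ _ _ oV sh Vy); exact: cong IH _ Vy.
elim: s t u => [|i s IH] t u st Vu.
  by move: st; rewrite perm_sym => /perm_nilP ->.
have it : i \in t by rewrite -(perm_mem st) mem_head.
case/splitPr: it st => t1 t2 st; rewrite -move_front//.
apply: cong Vu => y; apply: IH.
by move: st; rewrite perm_sym -(cat1s i t2) perm_catCA/= perm_cons perm_sym.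
Unshelve. all: by end_near. Qed.

Lemma closed_ball_near m (u : 'rV[R]_m) (P : 'rV[R]_m -> Prop) :
  (\forall y \near u, P y) ->
  exists2 e : R, 0 < e & forall y, `|y - u| <= e -> P y.
Proof.
move=> /nbhs_ballP[e /= e0 eP]; exists (e / 2); rewrite ?divr_gt0// => y ye.
apply: eP; rewrite -ball_normE /ball_/= distrC (le_lt_trans ye)//.
by rewrite ltr_pdivrMr// ltr_pMr// ltr1n.
Qed.

Lemma norm_le_dist (V : normedModType R) (x y : V) (e b : R) :
  `|x - y| <= e -> `|x| <= b -> `|y| <= e + b.
Proof.
move=> xy xb; rewrite -(subrK x y) (le_trans (ler_normD _ _))// lerD//.
by rewrite distrC.
Qed.

(** The first partial derivatives are continuous, hence bounded near [u], and
    the mean value inequality applies to each entry. *)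
Lemma csmooth_lipschitz m m' (V : set 'rV[R]_m) (h : 'rV[R]_m -> 'rV[R]_m') u :
  open V -> csmooth V h -> V u ->
  exists e L, [/\ 0 < e, 0 <= L & forall y z, `|y - u| <= e -> `|z - u| <= e ->
    `|h y - h z| <= L * `|y - z|].
Proof.
move=> oV sh Vu.
pose C := 1 + \big[Num.max/0]_(i < m) `|partial [:: i] h u|.
have : \forall y \near u, V y /\ forall i : 'I_m, `|partial [:: i] h y| <= C.
  near=> y; split; first by near: y; exact: open_nbhs_nbhs.
  near: y; apply: filter_forall => i.
  have [+ _] := sh [:: i] u Vu => /cvgrPdist_le /(_ 1 ltr01).
  apply: filterS => y yi; apply: norm_le_dist yi _.
  exact: (le_bigmax _ (fun i => `|partial [:: i] h u|)).
move=> /closed_ball_near[e e0 eP].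
have C0 : 0 <= C.
  by rewrite addr_ge0//; elim/big_ind: _ => // x y; rewrite le_max => ->.
exists e, (m%:R * C); split=> //; first by rewrite mulr_ge0.
move=> y z ye ze; apply/mx_norm_le; first by rewrite !mulr_ge0.
move=> o l; rewrite !mxE -mulrA.
apply: (@mean_value_cube _ _ (fun y => h y o l) u e C) => // x xe i.
have [Vx Cx] := eP x xe; have [_ dh] := sh [::] x Vx.
split; first exact/coord_derivable/dh.
by rewrite (coord_derive _ _ (dh i)) (le_trans _ (Cx i))// coord_le_mx_norm.
Unshelve. all: by end_near. Qed.

(** A map vanishing at [c] whose partial derivatives are bounded by [L] times
    the map itself vanishes on any cube so small that [m * L * e <= 1/2]: by the
    mean value inequality, a bound on the cube can always be halved. This takes
    the place of the uniqueness theorem for differential equations. *)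
Lemma derive_le_self_eq0 m n p (Q : 'rV[R]_m -> 'M[R]_(n, p)) c (e L B : R) :
  0 < e -> 0 <= L -> m%:R * L * e <= 2^-1 -> Q c = 0 ->
  (forall y, `|y - c| <= e -> `|Q y| <= B) ->
  (forall y, `|y - c| <= e -> forall i : 'I_m,
     derivable Q y (delta_mx 0 i) /\ `|'D_(delta_mx 0 i) Q y| <= L * `|Q y|) ->
  forall y, `|y - c| <= e -> Q y = 0.
Proof.
move=> e0 L0 mLe Qc QB dQ.
have B0 : 0 <= B by apply: le_trans (QB c _) => //; rewrite subrr normr0 ltW.
have half k y : `|y - c| <= e -> `|Q y| <= 2^-1 ^+ k * B.
  elim: k y => [|k IH] y ye; first by rewrite mul1r QB.
  have P0 : 0 <= 2^-1 ^+ k * B by rewrite mulr_ge0// exprn_ge0.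
  apply/mx_norm_le; first by rewrite mulr_ge0// exprn_ge0.
  move=> i j; pose q z := Q z i j.
  have -> : Q y i j = q y - q c by rewrite /q Qc mxE subr0.
  have := @mean_value_cube _ _ q c e (L * (2^-1 ^+ k * B)) _ c y.
  rewrite subrr normr0 => /(_ _ (ltW e0) ye) H.
  have {H}/le_trans -> // : `|q y - q c| <=
      m%:R * (L * (2^-1 ^+ k * B) * `|y - c|).
    apply: H => z ze l; have [dQz DQz] := dQ z ze l.
    split; first exact: coord_derivable.
    rewrite coord_derive// (le_trans (coord_le_mx_norm _ _ _))//.
    by rewrite (le_trans DQz)// ler_wpM2l// IH.
  rewrite exprS -[leRHS]mulrA.
  apply: (@le_trans _ _ (m%:R * L * e * (2^-1 ^+ k * B))); last first.
    exact: ler_wpM2r.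
  have -> : m%:R * L * e * (2^-1 ^+ k * B) = m%:R * (L * (2^-1 ^+ k * B) * e).
    by ring.
  by rewrite ler_wpM2l// ler_wpM2l// mulr_ge0.
move=> y ye; apply/eqP; rewrite -normr_le0.
have : (2^-1 ^+ k * B) @[k --> \oo] --> (0 * B : R).
  by apply: cvgMl; apply: cvg_expr; rewrite ger0_norm// invf_lt1// ltr1n.
rewrite mul0r => /cvgr_to_ge; apply.
by apply: nearW => k; exact: half.
Qed.

End SmoothCalculus.

(** * Complete systems in Euclidean space *)

Section LocalJets.
Local Open Scope ring_scope.
Context {R : realType} {m m' : nat}.
Implicit Types (f g : 'rV[R]_m -> 'rV[R]_m') (V : set 'rV[R]_m).

Definition jet_mx k f u : 'M[R]_(#|@multi_index m k|, m') :=
  \matrix_(i < #|@multi_index m k|) partial (val (enum_val i)) f u.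

(** Applied to a local expression of a map between manifolds, this is convertible
    to the jet coordinates of that map. *)
Definition jet_vec k f u : 'rV[R]_(m + #|@multi_index m k| * m') :=
  row_mx u (mxvec (jet_mx k f u)).

Lemma multi_index_of_sorted k (s : seq 'I_m) : (size s <= k)%N ->
  sorted (fun i j : 'I_m => (i <= j)%N) s ->
  exists i : 'I_#|@multi_index m k|, val (enum_val i) = s :> seq 'I_m.
Proof.
move=> sk ss; pose t : @multi_index m k := exist _ (Bseq sk) ss.
by exists (enum_rank t); rewrite enum_rankK.
Qed.

Lemma norm_jet_vecB k f g u :
  `|jet_vec k f u - jet_vec k g u| <= `|jet_mx k f u - jet_mx k g u|.
Proof.
apply/mx_norm_le => // o l; rewrite !mxE (ord1 o); case: splitP => j _.
  by rewrite subrr normr0.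
case/mxvec_indexP: j => i j; rewrite !mxvecE.
by apply: le_trans (coord_le_mx_norm _ i j); rewrite !mxE.
Qed.

Lemma jet_vec_coord k f u i j :
  jet_vec k f u 0 (rshift m (mxvec_index i j)) =
  partial (val (enum_val i)) f u 0 j.
Proof. by rewrite row_mxEr mxvecE mxE. Qed.

Lemma jet_vec_continuous k f V c (e : R) : open V -> csmooth V f -> V c ->
  0 < e -> \forall y \near c, `|jet_vec k f y - jet_vec k f c| <= e.
Proof.
move=> oV sf Vc e0.
have n1 : nbhs c [set y : 'rV[R]_m | forall j, `|c 0 j - y 0 j| <= e].
  apply: (@filter_forall _ _ _ _ (nbhs_filter c)) => j.
  have cj := @coord_continuous _ 1 m 0 j c.
  by move/cvgrPdist_le: cj => /(_ e e0).
have n2 : \forall y \near c, forall (i : 'I_#|@multi_index m k|) (j : 'I_m'),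
    `|partial (val (enum_val i)) f c 0 j - partial (val (enum_val i)) f y 0 j|
    <= e.
  apply: (@filter_forall _ _ _ _ (nbhs_filter c)) => i.
  apply: (@filter_forall _ _ _ _ (nbhs_filter c)) => j.
  have [ch _] := sf (val (enum_val i)) c Vc.
  have cj := continuous_coord (i := 0) (j := j) ch.
  by move/cvgrPdist_le: cj => /(_ e e0).
apply: filterS2 n1 n2 => y y1 y2.
apply/mx_norm_le; first exact: ltW.
move=> o l; rewrite !mxE (ord1 o) distrC; case: splitP => j _; first exact: y1.
by case/mxvec_indexP: j => i j; rewrite !mxvecE !mxE; exact: y2.
Qed.

Lemma jet_mx_eq k f g u : jet_vec k f u = jet_vec k g u ->
  jet_mx k f u = jet_mx k g u.
Proof. by move/eq_row_mx => [_ /(can_inj mxvecK)]. Qed.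

(** A derivative of an entry of the [k]-jet is a partial derivative of order at
    most [k.+1] and so, after sorting its indices, an entry of [jet_vec k.+1]. *)
Lemma jet_mx_derivative_le k f g V y (l : 'I_m) :
  open V -> csmooth V f -> csmooth V g -> V y ->
  derivable (fun z => jet_mx k f z - jet_mx k g z) y (delta_mx 0 l) /\
  `|'D_(delta_mx 0 l) (fun z => jet_mx k f z - jet_mx k g z) y| <=
    `|jet_vec k.+1 f y - jet_vec k.+1 g y|.
Proof.
move=> oV sf sg Vy.
have dpart h s o j : csmooth V h -> is_derive y (delta_mx 0 l)
    (fun z => partial s h z o j) (partial (l :: s) h y o j).
  move=> /(_ s y Vy)[_ /(_ l) dh]; apply: DeriveDef.
    exact: coord_derivable.
  exact: coord_derive.
have dentry i j : is_derive y (delta_mx 0 l)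
    (fun z => (jet_mx k f z - jet_mx k g z) i j)
    (partial (l :: val (enum_val i)) f y 0 j -
     partial (l :: val (enum_val i)) g y 0 j).
  have -> : (fun z => (jet_mx k f z - jet_mx k g z) i j) =
      (fun z => partial (val (enum_val i)) f z 0 j) \-
      (fun z => partial (val (enum_val i)) g z 0 j).
    by apply/funext => z; rewrite !mxE.
  by apply: is_deriveB; exact: dpart.
have dQ : derivable (fun z => jet_mx k f z - jet_mx k g z) y (delta_mx 0 l).
  by apply/derivable_mxP => i j; have [] := dentry i j.
split=> //; apply/mx_norm_le => // i j.
rewrite -(coord_derive _ _ dQ); have [_ ->] := dentry i j.
set s := l :: _.
pose leI := fun i j : 'I_m => (i <= j)%N.
have leI_total : total leI by move=> a b; exact: leq_total.
have [|i' i'E] := @multi_index_of_sorted k.+1 (sort leI s) _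
    (sort_sorted leI_total s).
  by rewrite size_sort /= ltnS size_bseq.
have perm_s : perm_eq s (sort leI s) by rewrite perm_sym perm_sort.
rewrite (partial_perm oV sf perm_s Vy) (partial_perm oV sg perm_s Vy) -i'E.
rewrite -!jet_vec_coord.
by have := coord_le_mx_norm (jet_vec k.+1 f y - jet_vec k.+1 g y) 0
  (rshift m (mxvec_index i' j)); rewrite mxE [X in _ + X]mxE.
Qed.

(** Two solutions of one complete system, which expresses the jet of order
    [k.+1] as a function [H] of the jet of order [k], coincide near a point
    where their [k]-jets do. The difference of the [k]-jets has derivatives
    bounded by the difference of the [k.+1]-jets, that is of two values of [H];
    as [H] is Lipschitz near the common initial jet, [derive_le_self_eq0]
    applies. *)
Lemma jet_system_unique k V f g c (W : set 'rV[R]_(m + #|@multi_index m k| * m'))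
    (H : 'rV[R]_(m + #|@multi_index m k| * m') ->
         'rV[R]_(m + #|@multi_index m k.+1| * m')) :
  open V -> V c -> csmooth V f -> csmooth V g ->
  open W -> csmooth W H -> W (jet_vec k f c) ->
  jet_vec k f c = jet_vec k g c ->
  (forall y, V y -> W (jet_vec k f y) ->
     H (jet_vec k f y) = jet_vec k.+1 f y) ->
  (forall y, V y -> W (jet_vec k g y) ->
     H (jet_vec k g y) = jet_vec k.+1 g y) ->
  \forall y \near c, f y = g y.
Proof.
move=> oV Vc sf sg oW sH Wc fgc Hf Hg.
set w0 := jet_vec k f c.
have [e1 [L [e10 L0 HL]]] := csmooth_lipschitz oW sH Wc.
have /closed_ball_near[e2 e20 We] : \forall w \near w0, W w.
  exact: open_nbhs_nbhs.
pose e3 := Num.min e1 e2.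
have e30 : 0 < e3 by rewrite lt_min e10.
have nf := jet_vec_continuous k oV sf Vc e30.
have ng := jet_vec_continuous k oV sg Vc e30.
have nV : \forall y \near c, V y by exact: open_nbhs_nbhs.
have [e4 e40 near_c] := closed_ball_near (filterS3 _
  (fun y a b c => And3 a b c) nf ng nV).
have mL0 : 0 < m%:R * L + 1 by rewrite ltr_wpDl// mulr_ge0.
pose d := Num.min e4 (2^-1 / (m%:R * L + 1)).
have d0 : 0 < d by rewrite lt_min e40 divr_gt0.
have mLd : m%:R * L * d <= 2^-1.
  apply: (@le_trans _ _ ((m%:R * L + 1) * d)).
    by rewrite ler_wpM2r// ?ltW// ltrDl.
  by rewrite mulrC -ler_pdivlMr// ge_min lexx orbT.
pose Q z := jet_mx k f z - jet_mx k g z.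
have near_d y : `|y - c| <= d -> [/\ `|jet_vec k f y - w0| <= e3,
    `|jet_vec k g y - w0| <= e3 & V y].
  rewrite /w0 {2}fgc => yd; apply: near_c.
  by rewrite (le_trans yd)// ge_min lexx.
have e3W w : `|w - w0| <= e3 -> W w.
  by move=> we; apply: We; rewrite (le_trans we)// ge_min lexx orbT.
have e3e1 w : `|w - w0| <= e3 -> `|w - w0| <= e1.
  by move=> we; rewrite (le_trans we)// ge_min lexx.
have Q0 : forall y, `|y - c| <= d -> Q y = 0.
  apply: (@derive_le_self_eq0 _ _ _ _ Q c d L (e3 + e3) d0 L0 mLd).
  - by rewrite /Q (jet_mx_eq fgc) subrr.
  - move=> y /near_d[yf yg _].
    apply/mx_norm_le; first by rewrite addr_ge0 ?ltW.
    move=> i j.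
    have -> : Q y i j = (jet_vec k f y - w0) 0 (rshift m (mxvec_index i j)) -
                        (jet_vec k g y - w0) 0 (rshift m (mxvec_index i j)).
      rewrite /Q [LHS]mxE [X in _ + X]mxE [in RHS]mxE [X in _ = _ + X - _]mxE.
      rewrite [X in _ = _ - X]mxE [X in _ = _ - (_ + X)]mxE !jet_vec_coord.
      by rewrite !mxE opprB addrA subrK.
    apply: le_trans (ler_normB _ _) (lerD _ _).
      exact: le_trans (coord_le_mx_norm _ _ _) yf.
    exact: le_trans (coord_le_mx_norm _ _ _) yg.
  - move=> y /near_d[yf yg Vy] l.
    have [dQ DQ] := jet_mx_derivative_le k l oV sf sg Vy.
    split; first exact: dQ.
    apply: le_trans DQ _.
    rewrite -(Hf y Vy (e3W _ yf)) -(Hg y Vy (e3W _ yg)).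
    apply: le_trans (HL _ _ (e3e1 _ yf) (e3e1 _ yg)) _.
    exact: ler_wpM2l L0 _ _ (norm_jet_vecB _ _ _ _).
have [i0 i0E] := @multi_index_of_sorted k [::] isT isT.
apply/nbhs_ballP; exists d => //= y.
rewrite -ball_normE /ball_/= distrC => /ltW /Q0 /matrixP E.
apply/rowP => j; have := E i0 j; rewrite !mxE i0E => /eqP.
by rewrite subr_eq0 => /eqP.
Qed.

End LocalJets.

(** * Jets on manifolds *)

Section ManifoldJets.
Local Open Scope ring_scope.
Local Notation coord := Defs.coord.

Lemma closure_eq (T U : topologicalType) (phi psi : T -> U) (S : set T) x :
  hausdorff_space U -> closure S x ->
  (\forall y \near x, S y -> phi y = psi y) ->
  {for x, continuous phi} -> {for x, continuous psi} -> phi x = psi x.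
Proof.
move=> hU Sx E cphi cpsi; apply: hU => A B nA nB.
have nA' : \forall y \near x, A (phi y) by exact: cphi.
have nB' : \forall y \near x, B (psi y) by exact: cpsi.
have [y [Sy [Ay By Ey]]] :=
  Sx _ (filterS3 (nbhs_filter x) (fun y a b c => And3 a b c) nA' nB' E).
by exists (phi y); split=> //; rewrite Ey.
Qed.

Lemma near_eq_partial (R : realType) m m' (f g : 'rV[R]_m -> 'rV[R]_m') s
    (u : 'rV[R]_m) :
  (\forall y \near u, f y = g y) ->
  \forall y \near u, partial s f y = partial s g y.
Proof.
move=> fg; elim: s => [//|i s IH].
by apply: filterS (near_join IH) => y; exact: near_eq_derive.
Qed.

Lemma csmooth_sub (R : realType) m m' (V V' : set 'rV[R]_m)
    (h : 'rV[R]_m -> 'rV[R]_m') :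
  V `<=` V' -> csmooth V' h -> csmooth V h.
Proof. by move=> VV' sh s u /VV'; exact: sh. Qed.

Context {R : realType} {m m' : nat}.
Variables (M : smooth_manifold R m) (M' : smooth_manifold R m').
Implicit Types (a : chart R m M) (b : chart R m' M') (f g : M -> M') (x : M).
Implicit Types (U O : set M) (k : nat).

(** A chart is an open map: the coordinates of the points near [x] fill a
    neighbourhood of [coord a x]. *)
Lemma near_chart a x (P : set M) : atlas a -> dom a x ->
  (\forall y \near x, P y) ->
  \forall u \near coord a x,
    exists y, [/\ dom a y, P y & u = coord a y].
Proof.
move=> aa ax nP.
have cx : cod a (coord a x) by exists x.
have n1 : \forall u \near coord a x, cod a u.
  exact: open_nbhs_nbhs (conj (chart_cod_open aa) cx).
have n2 : \forall u \near coord a x, P (param a u).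
  by apply: (chart_param_continuous aa cx); rewrite /= chart_coordK.
apply: filterS2 n1 n2 => u [y ay <-]; rewrite (chart_coordK aa ay) => Py.
by exists y.
Qed.

Lemma chart_image_open a O : atlas a -> open O ->
  open (coord a @` (dom a `&` O)).
Proof.
move=> aa oO; rewrite openE => _ [x [ax Ox] <-].
have := near_chart aa ax (open_nbhs_nbhs (conj oO Ox)).
by apply: filterS => u [y [ay Oy ->]]; exists y.
Qed.

Lemma open_preimage_on U f (B : set M') : open U -> smooth_on U f -> open B ->
  open (U `&` f @^-1` B).
Proof.
move=> oU [cf _] oB; rewrite openE => x [Ux Bfx].
apply: filterI; first exact: open_nbhs_nbhs.
by apply: (cf x Ux); exact: open_nbhs_nbhs.
Qed.

Lemma same_jet_refl k x f : same_jet k x f f.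
Proof. by []. Qed.

Lemma same_jet_sym k x f g : same_jet k x f g -> same_jet k x g f.
Proof.
move=> [fg E]; split=> // a b aa ab ax; rewrite -fg => bx s sk.
by apply/esym/E.
Qed.

Lemma same_jet_trans k x f g h :
  same_jet k x f g -> same_jet k x g h -> same_jet k x f h.
Proof.
move=> [fg E] [gh E']; split=> [|a b aa ab ax bx s sk]; first by rewrite fg.
by rewrite (E _ _ aa ab ax bx s sk) E' // -fg.
Qed.

(** Jets are sets of maps; equality of these sets is the equivalence relation
    [same_jet], provided that both maps belong to their own jets. *)
Lemma jet_eqP k x f g : smooth_near x f -> smooth_near x g ->
  jet k x f = jet k x g <-> same_jet k x f g.
Proof.
move=> sf sg; split=> [E|fg].
  suff : jet k x f g by case.
  by rewrite E; split=> //; exact: same_jet_refl.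
apply/seteqP; split=> h [sh H]; split=> //.
  exact: same_jet_trans (same_jet_sym fg) H.
exact: same_jet_trans fg H.
Qed.

Lemma near_eq_same_jet k x f g :
  (\forall y \near x, f y = g y) -> same_jet k x f g.
Proof.
move=> fg; split=> [|a b aa ab ax _ s _]; first exact: nbhs_singleton fg.
apply: (@nbhs_singleton _ (coord a x)
  (fun u => partial s (local_expr a b f) u = partial s (local_expr a b g) u)).
apply: near_eq_partial.
apply: filterS (near_chart aa ax fg) => _ [y [ay fgy ->]].
by rewrite /local_expr /= chart_coordK// fgy.
Qed.

Lemma jet_coord_same_jet k x f g a b : atlas a -> atlas b ->
  dom a x -> dom b (f x) -> same_jet k x f g ->
  jet_coord a b k x f = jet_coord a b k x g.
Proof.
move=> aa ab ax bx [_ E]; rewrite /jet_coord; congr (row_mx _ (mxvec _)).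
by apply/matrixP => i j; rewrite !mxE E// size_bseq.
Qed.

(** Although [jet_chart] is only the graph of a chart, the coordinates of a jet
    do not depend on the map chosen to represent it. *)
Lemma jet_chart_inj k x f a b w : atlas a -> atlas b -> smooth_near x f ->
  jet_chart a b k (x, jet k x f) w -> w = jet_coord a b k x f.
Proof.
move=> aa ab sf [y [g [sg [xy E] ax bx ->]]]; subst y.
apply: jet_coord_same_jet => //; apply: same_jet_sym.
exact: (jet_eqP k sf sg).1 E.
Qed.

(** Both the values and, in any two charts, the partial derivatives of [f] and
    [g] are continuous with values in Hausdorff spaces, so their equality passes
    to the closure. *)
Lemma same_jet_closed k U f g (S : set M) x : open U ->
  smooth_on U f -> smooth_on U g -> S `<=` [set y | same_jet k y f g] ->
  U x -> closure S x -> same_jet k x f g.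
Proof.
move=> oU sf sg SE Ux Sx.
have fgx : f x = g x.
  apply: closure_eq (@manifold_hausdorff _ _ M') Sx _ (sf.1 x Ux) (sg.1 x Ux).
  by apply: nearW => y /SE[].
split=> // a b aa ab ax bx s sk.
have ca := chart_coord_continuous aa ax.
have cpart h : smooth_on U h -> dom b (h x) ->
    {for x, continuous (fun y => partial s (local_expr a b h) (coord a y))}.
  move=> [_ /(_ a b aa ab) sh] bhx.
  have [|ch _] := sh s (coord a x); first by exists x.
  exact: continuous_comp ca ch.
apply: (closure_eq
  (phi := fun y => partial s (local_expr a b f) (coord a y))
  (psi := fun y => partial s (local_expr a b g) (coord a y))
  (@norm_hausdorff _ _) Sx).
- have oD := open_preimage_on oU sf (chart_dom_open ab).
  have n1 : \forall y \near x, dom a y.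
    exact: open_nbhs_nbhs (conj (chart_dom_open aa) ax).
  have n2 : \forall y \near x, (U `&` f @^-1` dom b) y.
    exact: open_nbhs_nbhs (conj oD (conj Ux bx)).
  by apply: filterS2 n1 n2 => y ay [_ fby] /SE[_]; apply.
- exact: cpart.
- by apply: cpart; rewrite -?fgx.
Qed.

(** In charts around [x] and [f x], the smoothness of [Phi] turns the relation
    between jets into a complete system with smooth right-hand side, which the
    local expressions of [f] and [g] both satisfy. *)
Lemma jet_relation_near_eq k (Phi : M * set (M -> M') -> M * set (M -> M'))
    U f g x :
  smooth_jet_map M M' k k.+1 Phi ->
  (forall h, h = f \/ h = g -> (exists h', diffeo_with_inverse U h h') /\
     forall y, U y -> (y, jet k.+1 y h) = Phi (y, jet k y h)) ->
  U x -> same_jet k x f g -> \forall y \near x, f y = g y.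
Proof.
move=> Phi_smooth relation Ux fg.
have [[f' df] _] := relation f (or_introl erefl).
have [[g' dg] _] := relation g (or_intror erefl).
have [oU _ _ sf _] := df; have [_ _ _ sg _] := dg.
have smoothU h y : smooth_on U h -> U y -> smooth_near y h.
  by move=> sh Uy; exists U.
have [a aa ax] := atlas_cover x; have [b ab bx] := atlas_cover (f x).
have bgx : dom b (g x) by rewrite -fg.1.
have step h : h = f \/ h = g -> smooth_on U h ->
    forall y, U y -> dom a y -> dom b (h y) ->
    [/\ invertible_jets M M' k (y, jet k y h),
        jet_chart a b k (y, jet k y h) (jet_coord a b k y h) &
        forall w, jet_chart a b k.+1 (Phi (y, jet k y h)) w <->
          w = jet_coord a b k.+1 y h].
  move=> hfg sh y Uy ay bhy; have [[h' dh] Ph] := relation h hfg; split.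
  - by exists y, h; split=> //; exists U, h'.
  - by exists y, h; split=> //; exact: smoothU.
  - move=> w; rewrite -(Ph y Uy); split.
      by apply: jet_chart_inj => //; exact: smoothU.
    by move=> ->; exists y, h; split=> //; exact: smoothU.
have ff : f = f \/ f = g by left.
have gg : g = f \/ g = g by right.
have [if_ cf Pf] := step f ff sf x Ux ax bx.
have [W [H [oW Ww sH HP]]] := Phi_smooth _ if_ _ _ _ _ aa ab aa ab _ _ cf
  ((Pf _).2 erefl).
pose O := (U `&` f @^-1` dom b) `&` (U `&` g @^-1` dom b).
have oO : open O.
  by apply: openI; apply: open_preimage_on => //; exact: chart_dom_open.
pose V := coord a @` (dom a `&` O).
have sV h : smooth_on U h -> O `<=` h @^-1` dom b ->
    csmooth V (local_expr a b h).
  move=> [_ sh] Oh; apply: csmooth_sub (sh a b aa ab) => _ [y [ay Oy] <-].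
  by exists y => //; split; [split=> //; case: Oy => -[]|exact: Oh].
have HV h : h = f \/ h = g -> smooth_on U h -> O `<=` h @^-1` dom b ->
    forall u, V u -> W (jet_vec k (local_expr a b h) u) ->
    H (jet_vec k (local_expr a b h) u) = jet_vec k.+1 (local_expr a b h) u.
  move=> hfg sh Oh _ [y [ay Oy] <-] Wy.
  have [ih ch Ph] := step h hfg sh y Oy.1.1 ay (Oh _ Oy).
  by apply/Ph; exact: HP ih ch Wy.
have Of : O `<=` f @^-1` dom b by move=> y [[]].
have Og : O `<=` g @^-1` dom b by move=> y [_ []].
have oV : open V by exact: chart_image_open.
have Vx : V (coord a x) by exists x.
have Ecoord := jet_system_unique oV Vx (sV f sf Of) (sV g sg Og) oW sH Ww
  (jet_coord_same_jet aa ab ax bx fg) (HV f ff sf Of) (HV g gg sg Og).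
have E : \forall y \near x,
    local_expr a b f (coord a y) = local_expr a b g (coord a y).
  exact: (chart_coord_continuous aa ax Ecoord).
have na : \forall y \near x, dom a y.
  exact: open_nbhs_nbhs (conj (chart_dom_open aa) ax).
have nO : \forall y \near x, O y by exact: open_nbhs_nbhs.
apply: filterS3 na nO E => y ay Oy.
rewrite /local_expr /= (chart_coordK aa ay) => E'.
by rewrite -(chart_coordK ab (Of _ Oy)) E' (chart_coordK ab (Og _ Oy)).
Qed.

End ManifoldJets.

(** * Unique determination by jets *)

Theorem corollary1p4 (R : realType) (n d n' d' : nat)
  (M : cr_manifold R n d) (M' : cr_manifold R n' d')
  (eq_dim : (n.*2 + d = n'.*2 + d')%N)
  (r : nat) (Phi : M * set (M -> M') -> M * set (M -> M'))
  (Phi_jet : forall z, invertible_jets M M' r z ->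
                       jet_bundle M M' r.+1 (Phi z))
  (Phi_smooth : smooth_jet_map M M' r r.+1 Phi)
  (Phi_cr : forall (U : set M) (f : M -> M'), cr_diffeo U f ->
     forall x, U x -> (x, jet r.+1 x f) = Phi (x, jet r x f)) :
  forall (U : set M) (f g : M -> M') (p : M),
    connected U -> cr_diffeo U f -> cr_diffeo U g ->
    U p -> jet r p f = jet r p g ->
    forall x, U x -> f x = g x.
Proof.
move=> U f g p cU crf crg Up jp.
have [f' [df _ _]] := crf; have [g' [dg _ _]] := crg.
have [oU _ _ sf _] := df; have [_ _ _ sg _] := dg.
have smoothU (h : M -> M') y : smooth_on U h -> U y -> smooth_near y h.
  by move=> sh Uy; exists U.
pose S := U `&` [set x | same_jet r x f g].
have near_eq x : S x -> \forall y \near x, f y = g y.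
  move=> [Ux fg]; apply: jet_relation_near_eq Phi_smooth _ Ux fg => h [->|->].
    by split; [exists f'|exact: Phi_cr].
  by split; [exists g'|exact: Phi_cr].
suff SU : S = U by move=> x Ux; move: Ux; rewrite -SU => -[_ []].
apply: cU.
- exists p; split=> //.
  exact: (jet_eqP r (smoothU f p sf Up) (smoothU g p sg Up)).1 jp.
- exists S; last by rewrite setIA setIid.
  rewrite openE => x Sx; have [Ux _] := Sx.
  have nU : \forall y \near x, U y by exact: open_nbhs_nbhs (conj oU Ux).
  apply: filterS2 nU (near_join (near_eq _ Sx)) => y Uy E.
  by split=> //; exact: near_eq_same_jet.
- exists (closure S); first exact: closed_closure.
  apply/seteqP; split=> x.
    by move=> Sx; split; [case: Sx|exact: subset_closure].
  move=> [Ux Sx]; split=> //.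
  by apply: same_jet_closed oU sf sg _ Ux Sx => y [].
Qed.
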